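(* Let $X$ be a set. For every continuous order-preserving map $f\colon\mathbb{V}^{\mathrm{c}}([0,1]^X)\to[0,1]$ there exist an at most countable set $Y$, a continuous order-preserving map $s\colon[0,1]^Y\to[0,1]$, a family $(h_y\colon[0,1]^X\to[0,1])_{y\in Y}$ of continuous order-preserving maps, and a family $(\otimes_y)_{y\in Y}$ of elements of $\{\Box,\Diamond\}$ such that $f=s\circ\langle\otimes_y\circ\mathbb{V}^{\mathrm{c}}h_y\rangle_{y\in Y}$.
   Context: $[0,1]^X$ carries the product topology and componentwise order; it is a compact ordered space (a compact Hausdorff space with a partial order closed in the square). For a subset $A$ of a poset, $\uparrow A$, $\downarrow A$ are up- and down-closure; $A$ is convex if $a_1\le x\le a_2$ with $a_i\in A$ implies $x\in A$; $\updownarrow A=\uparrow A\cap\downarrow A$. For a compact ordered space $Z$, $\mathbb{V}^{\mathrm{c}}Z$ is the set of closed convex subsets of $Z$ (including $\varnothing$), with topology generated by $\{K\mid K\cap U\neq\varnothing\}$ and $\{K\mid K\subseteq U\}$ for $U$ an open upset or open downset of $Z$, and Egli–Milner order $K\le L$ iff $\uparrow L\subseteq\uparrow K$ and $\downarrow K\subseteq\downarrow L$; for a continuous order-preserving $h$, $\mathbb{V}^{\mathrm{c}}h(K)=\updownarrow h[K]$. $\Box,\Diamond\colon\mathbb{V}^{\mathrm{c}}([0,1])\to[0,1]$ are $K\mapsto\inf K$ and $K\mapsto\sup K$ (with $\inf\varnothing=1$, $\sup\varnothing=0$). $\langle g_y\rangle_{y\in Y}$ denotes the map into the product induced by a family $(g_y)$.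 *)

(* Defs.v *)
From HB Require Import structures.
From mathcomp Require Import all_boot all_order all_algebra.
From mathcomp Require Import all_classical all_reals all_analysis.
Set Implicit Arguments. Unset Strict Implicit. Unset Printing Implicit Defensive.
Import Order.TTheory GRing.Theory Num.Theory numFieldNormedType.Exports.
Local Open Scope classical_set_scope.
Local Open Scope ring_scope.

Notation pt R X := {ptws X -> R}.

Definition unit_int {R : realType} : set R := [set t | 0 <= t <= 1].
Definition cube {R : realType} (X : Type) : set (pt R X) := [set p | forall x, 0 <= p x <= 1].

Definition ple {R : realType} (X : Type) (p q : pt R X) := forall x, p x <= q x.

Definition cube_monotone {R : realType} (X : Type) (h : pt R X -> R) :=
  forall p q, @cube R X p -> @cube R X q -> ple p q -> h p <= h q.

Definition upc {R : realType} (X : Type) (A : set (pt R X)) : set (pt R X) :=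
  [set z | @cube R X z /\ exists2 a, A a & ple a z].
Definition downc {R : realType} (X : Type) (A : set (pt R X)) : set (pt R X) :=
  [set z | @cube R X z /\ exists2 a, A a & ple z a].

Definition convex_set_ord {R : realType} (X : Type) (A : set (pt R X)) :=
  forall a1 a2 z, A a1 -> A a2 -> ple a1 z -> ple z a2 -> A z.

(** V^c([0,1]^X): closed convex subsets of [0,1]^X (empty set included).
    Since [0,1]^X is closed in R^X, closedness in the subspace is closedness
    in R^X together with inclusion in the cube. *)
Definition VcX {R : realType} (X : Type) : set (set (pt R X)) :=
  [set K | K `<=` @cube R X /\ closed K /\ convex_set_ord K].

Definition cube_open {R : realType} (X : Type) (U : set (pt R X)) :=
  U `<=` @cube R X /\ exists2 O : set (pt R X), open O & U = O `&` @cube R X.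

Definition cube_upset {R : realType} (X : Type) (U : set (pt R X)) :=
  forall a z, U a -> @cube R X z -> ple a z -> U z.
Definition cube_downset {R : realType} (X : Type) (U : set (pt R X)) :=
  forall a z, U a -> @cube R X z -> ple z a -> U z.

Definition Vc_subbasic {R : realType} (X : Type) (S : set (set (pt R X))) :=
  exists2 U, cube_open U /\ (cube_upset U \/ cube_downset U) &
    (S = [set K | K `&` U !=set0] \/ S = [set K | K `<=` U]).

Definition Vc_open {R : realType} (X : Type) (O : set (set (pt R X))) :=
  O `<=` @VcX R X /\
  forall K, O K -> exists2 l : seq (set (set (pt R X))),
    (forall S, S \in l -> Vc_subbasic S /\ S K) &
    (forall L, @VcX R X L -> (forall S, S \in l -> S L) -> O L).

Definition Vc_continuous {R : realType} (X : Type) (f : set (pt R X) -> R) :=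
  forall U : set R, open U -> Vc_open (@VcX R X `&` (f @^-1` U)).

Definition egli_milner {R : realType} (X : Type) (K L : set (pt R X)) :=
  upc L `<=` upc K /\ downc K `<=` downc L.

Definition Vc_monotone {R : realType} (X : Type) (f : set (pt R X) -> R) :=
  forall K L, @VcX R X K -> @VcX R X L -> egli_milner K L -> f K <= f L.

(** V^c h (K) = updown h[K], computed in [0,1] *)
Definition Vc_map {R : realType} (X : Type) (h : pt R X -> R) (K : set (pt R X)) : set R :=
  [set t | unit_int t /\ (exists2 a, K a & h a <= t) /\ (exists2 b, K b & t <= h b)].

Definition Box {R : realType} (L : set R) : R := if `[< L = set0 >] then 1 else inf L.
Definition Diamond {R : realType} (L : set R) : R := if `[< L = set0 >] then 0 else sup L.

Definition modal {R : realType} (b : bool) : set R -> R := if b then Box else Diamond.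

(* Main.v *)
(** If [K] is not below [L] in the Egli-Milner order, a Urysohn-type argument
    gives a continuous monotone [h] and a modality which takes the value 1 on a
    Vietoris neighbourhood of [K] and 0 on a neighbourhood of [L]. The space
    [VcX] is compact (every ultrafilter converges), so for each [n] finitely many
    such modal maps separate all pairs with [f K >= f L + 2^-n]. Countably many
    modal maps [e (n, i)] therefore determine [f] monotonically, and a
    McShane-type formula extends the induced map from the image of [VcX] to a
    continuous monotone map on the whole cube. *)
Require Import Defs.
From HB Require Import structures.
From mathcomp Require Import all_boot all_order all_algebra.
From mathcomp Require Import all_classical all_reals all_analysis.
From mathcomp Require Import lra.
Set Implicit Arguments. Unset Strict Implicit. Unset Printing Implicit Defensive.
Import Order.TTheory GRing.Theory Num.Theory numFieldNormedType.Exports.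
Local Open Scope classical_set_scope.
Local Open Scope ring_scope.

(** * Compactness and continuity tools *)

(** The sets [A] with [Q (K \ A)] form a filter containing [K]. If [Q K] failed, this filter would
    be proper and would cluster at some [k] in [K], yet it contains the complement of the
    neighbourhood of [k] on which [Q] holds. *)
Lemma compact_set_ind (T : topologicalType) (Q : set T -> Prop) (K : set T) :
  compact K -> Q set0 ->
  (forall A B, Q A -> Q B -> Q (A `|` B)) ->
  (forall A B, A `<=` B -> Q B -> Q A) ->
  (forall k, K k -> exists2 W, nbhs k W & Q W) -> Q K.
Proof.
move=> cK Q0 QU Qs Ql; apply: contrapT => nQK.
pose F := [set A | Q (K `\` A)].
have FF : ProperFilter F.
  split; first by move=> F0; apply: nQK; rewrite -(setD0 K).
  split=> [|A B FA FB|A B sAB].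
  - by rewrite /F /= setDT.
  - by rewrite /F /= setDIr; exact: QU.
  - by apply: Qs; apply: setDS.
have FK : F K by rewrite /F /= setDv.
have [k [Kk clk]] := cK _ FF FK.
have [W kW QW] := Ql _ Kk.
have FW : F (~` W) by rewrite /F /= setDE setCK; apply: Qs QW; apply: subIsetr.
by have [x [nWx Wx]] := clk _ _ FW kW.
Qed.

Lemma continuous_minr (R : realType) (T : topologicalType) (f g : T -> R) :
  continuous f -> continuous g -> continuous (f \min g).
Proof. by move=> fc gc x; exact: (continuous_min (fc x) (gc x)). Qed.

Lemma continuous_maxr (R : realType) (T : topologicalType) (f g : T -> R) :
  continuous f -> continuous g -> continuous (f \max g).
Proof. by move=> fc gc x; exact: (continuous_max (fc x) (gc x)). Qed.

Lemma clamp_continuous (R : realType) (c k : R) :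
  continuous (fun t : R => Num.min 1 (Num.max 0 ((t - c) / k))).
Proof.
have kc (a : R) : continuous (fun _ : R => a) by move=> t; exact: cvg_cst.
have ac : continuous (fun t : R => (t - c) / k).
  by move=> t; apply: cvgM; [apply: cvgB; [exact: cvg_id|exact: cvg_cst]|exact: cvg_cst].
exact: (continuous_minr (kc 1) (continuous_maxr (kc 0) ac)).
Qed.

(** * Order-preserving Urysohn separation in the cube *)

Section cube.
Context {R : realType} (X : Type).
Implicit Types (p q : pt R X) (A B C K L : set (pt R X)).

Lemma coord_continuous (x : X) : continuous (fun p : pt R X => p x).
Proof. exact: (@proj_continuous {classic X} (fun=> R) x). Qed.

Lemma compact_cube : compact (@cube R X).
Proof.
have /(@tychonoff {classic X} (fun=> R)) : forall x : X, compact `[0 : R, 1].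
  by move=> _; exact: segment_compact.
congr compact; apply/seteqP; split=> p pc x; have := pc x;
  by rewrite /= in_itv.
Qed.

Lemma closed_cube : closed (@cube R X).
Proof.
have -> : @cube R X =
    \bigcap_(x in [set: X]) ((fun p : pt R X => p x) @^-1` `[0, 1]).
  apply/seteqP; split=> [p pc x _|p pc x].
    by rewrite /= in_itv; apply: pc.
  by have := pc x I; rewrite /= in_itv.
apply: closed_bigI => x _; apply: preimage_closed.
- by move=> p _; exact: coord_continuous.
- exact: interval_closed.
Qed.

(** The three conditions are imposed on the whole product, not just on the cube, so that rescaling,
    maxima and minima carry no membership side conditions. *)
Definition urysohn (h : pt R X -> R) :=
  [/\ continuous h, forall p q, ple p q -> h p <= h q & forall p, 0 <= h p <= 1].

Lemma urysohn_cst (c : R) : 0 <= c <= 1 -> urysohn (fun=> c).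
Proof. by split; [exact: cst_continuous|move=> *|move=> *]. Qed.

Lemma urysohn_rescale (g : pt R X -> R) (c d : R) : c < d ->
  continuous g -> (forall p q, ple p q -> g p <= g q) ->
  exists2 h, urysohn h & (forall p, d <= g p -> h p = 1) /\
                         (forall p, g p <= c -> h p = 0).
Proof.
move=> cd gc gm; have dc : 0 < d - c by rewrite subr_gt0.
exists (fun p => Num.min 1 (Num.max 0 ((g p - c) / (d - c)))); first split.
- move=> p; exact: (continuous_comp (gc p) (@clamp_continuous R c (d - c) (g p))).
- move=> p q pq; rewrite le_min2 // le_max2 // ler_pM2r ?invr_gt0 //.
  by rewrite lerB // gm.
- by move=> p; rewrite le_min ler01 le_max lexx /= ge_min lexx.
- split=> p gp.
    by rewrite min_l // le_max ler_pdivlMr // mul1r lerB // orbT.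
  have : (g p - c) / (d - c) <= 0.
    by rewrite pmulr_lle0 ?invr_gt0 // subr_le0.
  by move=> /max_l ->; rewrite min_r.
Qed.

Definition separated A B :=
  exists2 h, urysohn h & (forall p, A p -> h p = 1) /\ (forall p, B p -> h p = 0).

Lemma separated_subset A A' B B' : A' `<=` A -> B' `<=` B ->
  separated A B -> separated A' B'.
Proof.
by move=> sA sB [h uh [h1 h0]]; exists h => //; split=> p => [/sA|/sB]; auto.
Qed.

Lemma separated_setUl A A' B :
  separated A B -> separated A' B -> separated (A `|` A') B.
Proof.
move=> [h [hc hm hI] [h1 h0]] [g [gc gm gI] [g1 g0]].
exists (h \max g); first split.
- exact: continuous_maxr.
- by move=> p q pq; rewrite le_max2 ?hm ?gm.
- move=> p; rewrite le_max ge_max.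
  by have /andP[-> ->] := hI p; have /andP[_ ->] := gI p.
split=> p /=; last by move=> Bp; rewrite h0 ?g0 // maxxx.
move=> [/h1 ->|/g1 ->].
- by rewrite max_l //; have /andP[] := gI p.
- by rewrite max_r //; have /andP[] := hI p.
Qed.

Lemma separated_setUr A B B' :
  separated A B -> separated A B' -> separated A (B `|` B').
Proof.
move=> [h [hc hm hI] [h1 h0]] [g [gc gm gI] [g1 g0]].
exists (h \min g); first split.
- exact: continuous_minr.
- by move=> p q pq; rewrite le_min2 ?hm ?gm.
- move=> p; rewrite le_min ge_min.
  by have /andP[-> ->] := hI p; have /andP[-> _] := gI p.
split=> p /=; first by move=> Ap; rewrite h1 ?g1 // minxx.
move=> [/h0 ->|/g0 ->].
- by rewrite min_l //; have /andP[] := gI p.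
- by rewrite min_r //; have /andP[] := hI p.
Qed.

Lemma separated_set0l B : separated set0 B.
Proof.
exists (fun=> 0); last by split.
by apply: urysohn_cst; rewrite lexx ler01.
Qed.

Lemma separated_set0r A : separated A set0.
Proof.
exists (fun=> 1); last by split.
by apply: urysohn_cst; rewrite lexx ler01.
Qed.

(** Some coordinate has [q x < p x]. Cutting this gap at one third and two thirds leaves strict room
    on both sides, so the neighbourhoods can be half-spaces in the coordinate [x]. *)
Lemma nle_separated_nbhs p q : ~ ple p q ->
  exists W W', [/\ nbhs p W, nbhs q W' & separated W W'].
Proof.
move=> /existsNP[x /negP]; rewrite -ltNge => qp.
have [h uh [h1 h0]] : exists2 h, urysohn h &
    (forall r, q x + (p x - q x) * (2 / 3) <= r x -> h r = 1) /\
    (forall r, r x <= q x + (p x - q x) / 3 -> h r = 0).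
  apply: (@urysohn_rescale (fun r => r x)); first lra.
  - exact: coord_continuous.
  - by move=> r s; exact.
exists [set r : pt R X | q x + (p x - q x) * (2 / 3) < r x],
       [set r : pt R X | r x < q x + (p x - q x) / 3]; split.
- apply: (@coord_continuous x p [set t | q x + (p x - q x) * (2 / 3) < t]).
  by apply: open_nbhs_nbhs; split; [exact: open_gt|rewrite /=; lra].
- apply: (@coord_continuous x q [set t | t < q x + (p x - q x) / 3]).
  by apply: open_nbhs_nbhs; split; [exact: open_lt|rewrite /=; lra].
- by exists h => //; split=> r /= /ltW; [exact: h1|exact: h0].
Qed.

(** Compactness is used twice: over [B] for a fixed [p], then over [A]. The inner induction carries
    a neighbourhood of [p], which is intersected each time two pieces of [B] are joined. *)
Lemma compact_separated A B : compact A -> compact B ->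
  (forall p q, A p -> B q -> ~ ple p q) -> separated A B.
Proof.
move=> cA cB AB; apply: (compact_set_ind (Q := fun A => separated A B) cA).
- exact: separated_set0l.
- by move=> *; exact: separated_setUl.
- by move=> A1 A2 sA; exact: separated_subset.
move=> p Ap; have {}AB q : B q -> ~ ple p q by exact: AB.
apply: (compact_set_ind (Q := fun B => exists2 W, nbhs p W & separated W B) cB).
- by exists setT; [exact: filterT|exact: separated_set0r].
- move=> B1 B2 [W1 pW1 s1] [W2 pW2 s2]; exists (W1 `&` W2); first exact: filterI.
  by apply: separated_setUr; [apply: separated_subset s1|apply: separated_subset s2].
- by move=> B1 B2 sB [W pW s]; exists W => //; apply: separated_subset s.
- move=> q /AB/nle_separated_nbhs[W [W' [pW qW' s]]].
  by exists W' => //; exists W.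
Qed.

Lemma VcX_compact K : VcX K -> compact K.
Proof. by move=> [Kc [cK _]]; exact: subclosed_compact compact_cube Kc. Qed.

Lemma upset_of_monotone (h : pt R X -> R) (c : R) :
  urysohn h -> cube_open [set p | cube p /\ c < h p] /\
               cube_upset [set p | cube p /\ c < h p].
Proof.
move=> [hc hm _]; split; last first.
  by move=> a z /= [_ ca] zc az; split=> //; apply: lt_le_trans ca (hm _ _ az).
split; first by move=> p [].
exists (h @^-1` [set t | c < t]); last by rewrite setIC.
by apply: open_comp; [move=> p _; exact: hc|exact: open_gt].
Qed.

Lemma downset_of_monotone (h : pt R X -> R) (c : R) :
  urysohn h -> cube_open [set p | cube p /\ h p < c] /\
               cube_downset [set p | cube p /\ h p < c].
Proof.
move=> [hc hm _]; split; last first.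
  by move=> a z /= [_ ac] zc za; split=> //; apply: le_lt_trans (hm _ _ za) ac.
split; first by move=> p [].
exists (h @^-1` [set t | t < c]); last by rewrite setIC.
by apply: open_comp; [move=> p _; exact: hc|exact: open_lt].
Qed.

(** Rescaling [g] between 1/3 and 2/3 makes the new function constant on an open upset around [A]
    and on an open downset around [B]; these are the sets that define subbasic Vietoris
    neighbourhoods. *)
Lemma separated_nbhs A B : A `<=` @cube R X -> B `<=` @cube R X -> separated A B ->
  exists h U V, [/\ urysohn h,
    [/\ cube_open U, cube_upset U, A `<=` U & forall p, U p -> h p = 1] &
    [/\ cube_open V, cube_downset V, B `<=` V & forall p, V p -> h p = 0]].
Proof.
move=> Ac Bc [g ug [g1 g0]]; have [gc gm gI] := ug.
have [|h uh [h1 h0]] := @urysohn_rescale g (1 / 3) (2 / 3) _ gc gm; first lra.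
have [Uo Uu] := upset_of_monotone (2 / 3) ug.
have [Vo Vd] := downset_of_monotone (1 / 3) ug.
exists h, [set p | cube p /\ 2 / 3 < g p], [set p | cube p /\ g p < 1 / 3].
split=> //; split=> //.
- by move=> p Ap; split; [exact: Ac|rewrite g1 //; lra].
- by move=> p [_ /ltW]; exact: h1.
- by move=> p Bp; split; [exact: Bc|rewrite g0 //; lra].
- by move=> p [_ /ltW]; exact: h0.
Qed.

(** * Extreme values of the modalities *)

Lemma modal_le1 b (h : pt R X -> R) K : modal b (Vc_map h K) <= 1.
Proof.
case: b; rewrite /modal /Box /Diamond; case: asboolP => // /eqP/set0P[t Kt].
- have /andP[_ t1] : 0 <= t <= 1 by have [] := Kt.
  apply: le_trans t1; apply: ge_inf => //.
  by exists 0 => u [/andP[]].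
- by apply: ge_sup; [exists t|move=> u [/andP[]]].
Qed.

(** The empty [K] is covered by the convention that the infimum of the empty set is 1; dually for
    [Diamond0]. *)
Lemma Box1 (h : pt R X -> R) K :
  (forall p, K p -> h p = 1) -> Box (Vc_map h K) = 1.
Proof.
move=> h1; rewrite /Box; case: asboolP => // /eqP/set0P K0.
suff -> : Vc_map h K = [set 1] by rewrite inf1.
apply/seteqP; split=> [t [/andP[_ t1] [[a Ka at_] _]]|_ ->].
  by apply/eqP; rewrite /= eq_le t1 -(h1 _ Ka).
move: K0 => [t [_ [[a Ka _] _]]]; split; first by rewrite /unit_int /= ler01 lexx.
by split; exists a => //; rewrite h1.
Qed.

Lemma Diamond0 (h : pt R X -> R) K :
  (forall p, K p -> h p = 0) -> Diamond (Vc_map h K) = 0.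
Proof.
move=> h0; rewrite /Diamond; case: asboolP => // /eqP/set0P K0.
suff -> : Vc_map h K = [set 0] by rewrite sup1.
apply/seteqP; split=> [t [/andP[t0 _] [_ [a Ka at_]]]|_ ->].
  by apply/eqP; rewrite /= eq_le t0 -(h0 _ Ka) at_.
move: K0 => [t [_ [[a Ka _] _]]]; split; first by rewrite /unit_int /= ler01 lexx.
by split; exists a => //; rewrite h0.
Qed.

Lemma Vc_map_image (h : pt R X -> R) K p : urysohn h -> K p -> Vc_map h K (h p).
Proof. by move=> [_ _ hI] Kp; split; [exact: hI|split; exists p]. Qed.

Lemma Box0 (h : pt R X -> R) K p :
  urysohn h -> K p -> h p = 0 -> Box (Vc_map h K) = 0.
Proof.
move=> uh Kp hp; have := Vc_map_image uh Kp; rewrite hp => K0.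
rewrite /Box; case: asboolP => [E|_]; first by rewrite E in K0.
apply/eqP; rewrite eq_le; apply/andP; split.
- by apply: ge_inf => //; exists 0 => t [/andP[]].
- by apply: lb_le_inf; [exists 0|move=> t [/andP[]]].
Qed.

Lemma Diamond1 (h : pt R X -> R) K p :
  urysohn h -> K p -> h p = 1 -> Diamond (Vc_map h K) = 1.
Proof.
move=> uh Kp hp; have := Vc_map_image uh Kp; rewrite hp => K1.
rewrite /Diamond; case: asboolP => [E|_]; first by rewrite E in K1.
apply/eqP; rewrite eq_le; apply/andP; split.
- by apply: ge_sup; [exists 1|move=> t [/andP[]]].
- by apply: ub_le_sup => //; exists 1 => t [/andP[]].
Qed.

(** * Splitting pairs that violate the Egli-Milner order *)

Definition modal_splits (hb : (pt R X -> R) * bool) K L :=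
  modal hb.2 (Vc_map hb.1 K) = 1 /\ modal hb.2 (Vc_map hb.1 L) = 0.

Lemma not_egli_milner_splits K L : VcX K -> VcX L -> ~ egli_milner K L ->
  exists hb SK SL, [/\ urysohn hb.1, Vc_subbasic SK /\ SK K,
    Vc_subbasic SL /\ SL L &
    forall K' L', SK K' -> SL L' -> modal_splits hb K' L'].
Proof.
move=> VK VL nKL; have [[Kc _] [Lc _]] := (VK, VL).
have point_in_cube (P : set (pt R X)) p : P `<=` @cube R X -> P p -> [set p] `<=` @cube R X.
  by move=> Pc Pp _ ->; exact: Pc.
have [/existsNP[q /not_implyP[[qc [l Ll lq]] nKq]]|
      /existsNP[q /not_implyP[[qc [k Kk qk]] nLq]]] :
    ~ (upc L `<=` upc K) \/ ~ (downc K `<=` downc L).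
  by apply: contrapT => /not_orP[/contrapT ? /contrapT ?]; apply: nKL.
(* The point [l] of [L] lies above no point of [K], so [Box] works: it is 1 on sets inside [U] and 0
   on sets meeting [V]. *)
- have s : separated K [set l].
    apply: compact_separated; [exact: VcX_compact|exact: compact_set1|].
    move=> k _ Kk -> kl; apply: nKq; split=> //; exists k => // x.
    exact: le_trans (kl x) (lq x).
  have [h [U [V [uh [Uo Uu KU h1] [Vo Vd LV h0]]]]] :=
    separated_nbhs Kc (point_in_cube _ _ Lc Ll) s.
  exists (h, true), [set M | M `<=` U], [set M | M `&` V !=set0]; split=> //.
  + by split=> //; exists U; [split=> //; left|right].
  + by split; [exists V; [split=> //; right|left]|exists l; split=> //; exact: LV].
  move=> K' L' K'U [l' [L'l' Vl']]; split.
  + by apply: Box1 => p /K'U/h1.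
  + by apply: Box0 L'l' _ => //; exact: h0.
(* Dually, [k] lies below no point of [L], and [Diamond] is 1 on sets meeting [U] and 0 on sets
   inside [V]. *)
- have s : separated [set k] L.
    apply: compact_separated; [exact: compact_set1|exact: VcX_compact|].
    move=> _ l -> Ll kl; apply: nLq; split=> //; exists l => // x.
    exact: le_trans (qk x) (kl x).
  have [h [U [V [uh [Uo Uu KU h1] [Vo Vd LV h0]]]]] :=
    separated_nbhs (point_in_cube _ _ Kc Kk) Lc s.
  exists (h, false), [set M | M `&` U !=set0], [set M | M `<=` V]; split=> //.
  + by split; [exists U; [split=> //; left|left]|exists k; split=> //; exact: KU].
  + by split=> //; exists V; [split=> //; right|right].
  move=> K' L' [k' [K'k' Uk']] L'V; split.
  + by apply: Diamond1 K'k' _ => //; exact: h1.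
  + by apply: Diamond0 => p /L'V/h0.
Qed.

(** * Compactness of the Vietoris space via ultrafilters *)

(** The limit consists of the points all of whose open up- or downset neighbourhoods meet [F]-almost
    every [k t]. Subbasic sets of the meeting kind are then immediate; those of the containment kind
    use compactness of the cube. *)
Lemma VcX_ultra_limit (T : Type) (F : set_system T) (k : T -> set (pt R X)) :
  UltraFilter F -> F [set t | VcX (k t)] ->
  exists2 K, VcX K & forall S, Vc_subbasic S -> S K -> F [set t | S (k t)].
Proof.
move=> FU FV.
pose K : set (pt R X) := [set z | cube z /\ forall U, cube_open U ->
  cube_upset U \/ cube_downset U -> U z -> F [set t | k t `&` U !=set0]].
have KV : VcX K.
  split; first by move=> z [].
  split.
    move=> z Kz; have zc : cube z.
      by apply: closed_cube; apply: closure_subset Kz => ? [].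
    split=> // U Uo Uud Uz; have [_ [W Wo UW]] := Uo.
    have [w [[wc Kw] Ww]] : K `&` W !=set0.
      by apply: Kz; apply: open_nbhs_nbhs; split=> //; move: Uz; rewrite UW => -[].
    by apply: Kw => //; rewrite UW.
  move=> a1 a2 z [a1c Ka1] [a2c Ka2] a1z za2; have zc : cube z.
    move=> x; have /andP[a10 _] := a1c x; have /andP[_ a21] := a2c x.
    by rewrite (le_trans a10 (a1z x)) (le_trans (za2 x) a21).
  (* An upset around [z] also contains [a2], and a downset around [z] also contains [a1]. *)
  split=> // U Uo Uud Uz; case: (Uud) => [Uu|Ud].
  - by apply: Ka2 => //; exact: Uu Uz a2c za2.
  - by apply: Ka1 => //; exact: Ud Uz a1c a1z.
exists K => // _ [U [Uo Uud] [->|->]].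
  by move=> [z [[zc Kz] Uz]]; exact: Kz.
move=> KU; have [//|FnU] := in_ultra_setVsetC [set t | k t `<=` U] FU.
have [_ [W Wo UW]] := Uo.
have cC : compact (@cube R X `&` ~` W).
  by apply: compact_closedI; [exact: compact_cube|exact: open_closedC].
(* If containment in [U] fails, almost every [k t] has a point [g t] outside [U]. A cluster point of
   [g] stays outside [U] and will be shown to lie in [K], contradicting [KU]. *)
have /choice[g gP] t : exists z : pt R X,
    VcX (k t) -> ~ (k t `<=` U) -> k t z /\ (cube z /\ ~ W z).
  have [[VK /existsNP[z /not_implyP[kz nUz]]]|n] :=
      pselect (VcX (k t) /\ ~ (k t `<=` U)); last first.
    by exists (fun=> 0) => ? ?; case: n.
  exists z => _ _; have zc : cube z by apply VK.1.
  by split=> //; split=> // Wz; apply: nUz; rewrite UW.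
have Fg : F [set t | k t (g t) /\ (cube (g t) /\ ~ W (g t))].
  by apply: filterS (filterI FV FnU) => t [Vt nt]; exact: gP.
have [z [[zc nWz] clz]] : (@cube R X `&` ~` W) `&` cluster (g @ F) !=set0.
  by apply: (cC _ (fmap_proper_filter g _)); apply: (@filterS _ F) Fg => t [].
suff Kz : K z by have := KU z Kz; rewrite UW => -[/nWz].
split=> // U' [_ [W' W'o U'W]] _ U'z.
(* If almost every [k t] missed [U'], then [g] would almost always avoid [W'], a neighbourhood of
   its cluster point [z]. *)
have [//|FnU'] := in_ultra_setVsetC [set t | k t `&` U' !=set0] FU.
have gW' : (g @ F) (~` W').
  apply: (@filterS _ F) (filterI Fg FnU') => t [[kg [gc _]] nU'] W'g.
  by apply: nU'; exists (g t); split=> //; rewrite U'W.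
have [w [nW'w W'w]] : ~` W' `&` W' !=set0.
  by apply: clz => //; apply: open_nbhs_nbhs; split=> //; move: U'z; rewrite U'W => -[].
by [].
Qed.

(** A Vietoris neighbourhood of [K] contains a finite intersection of subbasic ones, and finite
    intersections of sets of [F] stay in [F]. *)
Lemma Vc_continuous_limit (T : Type) (F : set_system T) (k : T -> set (pt R X))
    (f : set (pt R X) -> R) K (U : set R) :
  Filter F -> F [set t | VcX (k t)] -> Vc_continuous f -> VcX K ->
  (forall S, Vc_subbasic S -> S K -> F [set t | S (k t)]) ->
  open U -> U (f K) -> F [set t | U (f (k t))].
Proof.
move=> FF FV fc VK Kl Uo UfK.
have [l lS lU] := (fc _ Uo).2 K (conj VK UfK).
have Fl : F [set t | forall S, S \in l -> S (k t)].
  elim: l lS {lU} => [|S l IH] lS; first by apply: filterS FV.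
  have FS : F [set t | S (k t)].
    by have [] := lS S (mem_head _ _); exact: Kl.
  have {IH} Fl : F [set t | forall S, S \in l -> S (k t)].
    by apply: IH => S' S'l; apply: lS; rewrite inE S'l orbT.
  apply: filterS (filterI FS Fl) => t [St lt] S'.
  by rewrite inE => /orP[/eqP ->|/lt].
by apply: filterS (filterI FV Fl) => t [Vt /(lU _ Vt)[]].
Qed.

(** * Finitely many modal maps for each gap *)

(** Default value for [nth]: its function satisfies [urysohn], so indices past the end of a list
    still give admissible maps. *)
Definition trivial_modality : (pt R X -> R) * bool := (fun=> 0, true).

(** Otherwise the sets [B s] of pairs with gap [e] not split by [s] generate a proper filter. An
    ultrafilter refining it has a limit pair, which some modal map splits together with all nearby
    pairs. *)
Lemma finite_modal_separation (f : set (pt R X) -> R) (e : R) :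
  Vc_continuous f -> Vc_monotone f -> 0 < e ->
  exists2 s, (forall i, urysohn (nth trivial_modality s i).1) &
    forall K L, VcX K -> VcX L -> f L + e <= f K ->
      exists2 i, (i < size s)%N & modal_splits (nth trivial_modality s i) K L.
Proof.
move=> fc fm e0; set d := trivial_modality; apply: contrapT => nS.
have ud : urysohn d.1 by apply: urysohn_cst; rewrite lexx ler01.
pose D := [set s | forall i, urysohn (nth d s i).1].
pose B s := [set KL : set (pt R X) * set (pt R X) | [/\ VcX KL.1, VcX KL.2,
  f KL.2 + e <= f KL.1 &
  forall i, (i < size s)%N -> ~ modal_splits (nth d s i) KL.1 KL.2]].
have D0 : D [::] by move=> i; rewrite nth_nil.
have FF : ProperFilter (filter_from D B).
  apply: filter_from_proper.
    apply: filter_from_filter; first by exists [::].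
    (* A pair unsplit by the concatenation is unsplit by both lists. *)
    move=> s1 s2 Ds1 Ds2; exists (s1 ++ s2).
      by move=> i; rewrite nth_cat; case: ifP.
    move=> [K L] [VK VL fKL nKL]; split; split=> // i si.
      have := nKL i; rewrite nth_cat si; apply.
      by rewrite size_cat (leq_trans si) ?leq_addr.
    have := nKL (size s1 + i)%N; rewrite nth_cat.
    have -> : (size s1 + i < size s1)%N = false by rewrite ltnNge leq_addr.
    rewrite addKn; apply.
    by rewrite size_cat ltn_add2l.
  move=> s Ds; apply: contrapT => nB; apply: nS; exists s => // K L VK VL fKL.
  apply: contrapT => nKL; apply: nB; exists (K, L); split=> // i si sKL.
  by apply: nKL; exists i.
have [G [GU FG]] := ultraFilterLemma FF.
have GB s : D s -> G (B s) by move=> Ds; apply: FG; exists s.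
have G1 : G [set t | VcX t.1] by apply: filterS (GB _ D0) => t [].
have G2 : G [set t | VcX t.2] by apply: filterS (GB _ D0) => t [].
have [K VK Kl] := VcX_ultra_limit GU G1.
have [L VL Ll] := VcX_ultra_limit GU G2.
(* If [K] were below [L], then [f K <= f L], and moving each value by less than [e / 2] could not
   produce a gap of [e]. *)
have nKL : ~ egli_milner K L.
  move=> /(fm _ _ VK VL) fKL.
  have GK : G [set t | f t.1 < f K + e / 2].
    apply: (Vc_continuous_limit (U := [set t | t < f K + e / 2]) _ G1 fc VK Kl).
      exact: open_lt.
    by rewrite /=; lra.
  have GL : G [set t | f L - e / 2 < f t.2].
    apply: (Vc_continuous_limit (U := [set t | f L - e / 2 < t]) _ G2 fc VL Ll).
      exact: open_gt.
    by rewrite /=; lra.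
  have [t /= [[tK tL] [_ _ tKL _]]] := filter_ex (filterI (filterI GK GL) (GB _ D0)).
  by move: tK tL tKL => /=; lra.
have [hb [SK [SL [uhb [sSK SKK] [sSL SLL] hbKL]]]] := not_egli_milner_splits VK VL nKL.
have Dhb : D [:: hb] by move=> [|i] //=; rewrite nth_nil.
have [t [[tK tL] [_ _ _ /(_ 0%N isT)]]] :=
  filter_ex (filterI (filterI (Kl _ sSK SKK) (Ll _ sSL SLL)) (GB _ Dhb)).
by apply; exact: hbKL.
Qed.

End cube.

(** * Monotone extension from countably many coordinates *)

Lemma dyadic_le (R : realType) (e : R) : 0 < e -> exists n, 2^-1 ^+ n <= e.
Proof.
move=> e0; exists (Num.bound e^-1); rewrite exprVn -[leRHS]invrK lef_pV2.
- have /ltW/le_trans-> // : e^-1 < (Num.bound e^-1)%:R.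
    by apply: archi_boundP; rewrite invr_ge0 ltW.
  by rewrite -natrX ler_nat ltnW // ltn_expl.
- by rewrite posrE exprn_gt0.
- by rewrite posrE invr_gt0.
Qed.

(** Take the least [n] whose power is at most [r]; minimality gives the upper bound, or [r <= 1]
    does when [n] is 0. The factor 2 here is the one in the weights [w n] of the extension. *)
Lemma dyadic_bracket (R : realType) (r : R) : 0 < r <= 1 ->
  exists n, 2^-1 ^+ n <= r <= 2 * 2^-1 ^+ n.
Proof.
move=> /andP[r0 r1]; case: (ex_minnP (dyadic_le r0)) => -[|n] rn nmin.
  by exists 0%N; rewrite rn expr0 mulr1 (le_trans r1) // ler1n.
exists n.+1; rewrite rn exprS mulrA divff ?mul1r ?pnatr_eq0 //=.
by rewrite leNgt; apply/negP => /ltW/nmin; rewrite ltnn.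
Qed.

(* The extension is the McShane-type formula
   [s p = max 0 (sup_K inf_n (f K - 2 * 2^-n * max_i (e K (n, i) - p (n, i))^+))],
   written as the supremum of the set of all [t] below one of these infima,
   together with [0]. *)
Lemma monotone_extension (R : realType) (T : Type) (V : set T) (f : T -> R)
    (e : T -> pt R (nat * nat)) (N : nat -> nat) :
  (forall K, V K -> unit_int (f K)) -> (forall K y, e K y <= 1) ->
  (forall n K L, V K -> V L -> f L + 2^-1 ^+ n <= f K ->
    exists2 i, (i < N n)%N & e K (n, i) = 1 /\ e L (n, i) = 0) ->
  exists s : pt R (nat * nat) -> R,
    [/\ forall p, unit_int (s p), {within @cube R (nat * nat), continuous s},
        forall p q, ple p q -> s p <= s q & forall K, V K -> f K = s (e K)].
Proof.
move=> f01 e1 fe; pose w n : R := 2 * 2^-1 ^+ n.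
have w_ge0 n : 0 <= w n by rewrite mulr_ge0 // exprn_ge0 // invr_ge0.
have w_le m n : (m <= n)%N -> w n <= w m.
  by move=> mn; rewrite ler_pM2l // ler_wiXn2l // ?invr_ge0 // invf_le1 // ler1n.
(* The bound [t <= f K] accounts for the positive part of the differences. *)
pose S (p : pt R (nat * nat)) : set R := [set t | t = 0 \/ exists2 K, V K &
  t <= f K /\ forall n i, (i < N n)%N -> t + w n * (e K (n, i) - p (n, i)) <= f K].
have S1 p t : S p t -> t <= 1.
  by move=> [->//|[K VK [tK _]]]; have /andP[_] := f01 _ VK; exact: le_trans.
have S0 p : S p 0 by left.
have S_sup p t : S p t -> t <= sup (S p).
  by move=> Spt; apply: ub_le_sup => //; exists 1 => u; exact: S1.
have sup_S p u : (forall t, S p t -> t <= u) -> sup (S p) <= u.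
  by move=> Su; apply: ge_sup; first by exists 0.
exists (fun p => sup (S p)); split.
- move=> p; apply/andP; split; first exact: S_sup.
  by apply: sup_S => t; exact: S1.
(* Lowering [t] by [eps] moves it from [S p] to [S q], unless [t] is 0. For [n < M] the weight is at
   most 2 and the coordinates differ by at most [eps / 2]; for larger [n] the weight is at most
   [eps] and [e K - q] is at most 1. *)
- have approx p q eps M : 0 < eps -> w M <= eps -> cube q ->
      (forall n i, (n < M)%N -> (i < N n)%N -> `|p (n, i) - q (n, i)| <= eps / 2) ->
      sup (S p) <= sup (S q) + eps.
    move=> eps0 wM qc pq; apply: sup_S => t [->|[K VK [tK tp]]].
      by apply: addr_ge0; [exact: S_sup|exact: ltW].
    rewrite -lerBlDr; apply: S_sup; right; exists K => //; split; first by lra.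
    move=> n i iN; have [nM|Mn] := ltnP n M.
      have := tp n i iN; have := pq n i nM iN.
      rewrite ler_norml => /andP[_ pqni] tni.
      have wn2 : w n <= 2 by have := w_le 0%N n isT; rewrite /w expr0 mulr1.
      have : w n * (p (n, i) - q (n, i)) <= w n * (eps / 2).
        by rewrite ler_wpM2l.
      have : w n * (eps / 2) <= 2 * (eps / 2) by rewrite ler_wpM2r //; lra.
      move: tni; rewrite !mulrBr; lra.
    have : w n * (e K (n, i) - q (n, i)) <= w n * 1.
      rewrite ler_wpM2l //.
      by have := e1 K (n, i); have /andP[] := qc (n, i); lra.
    by have := w_le _ _ Mn; lra.
  apply/subspace_continuousP => p pc; apply/cvgrPdist_le => eps eps0.
  have [M wM] : exists M, w M <= eps.
    have [|M hM] := @dyadic_le R (eps / 2); first by lra.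
    by exists M; rewrite /w; lra.
  (* Only finitely many coordinates are constrained, so this is a neighbourhood in the product
     topology. *)
  have pq : \forall q \near nbhs p, forall (n : 'I_M) (i : 'I_(N n)),
      `|p (val n, val i) - q (val n, val i)| <= eps / 2.
    apply: filter_forall => n; apply: filter_forall => i.
    apply: (@coord_continuous R _ (val n, val i) p
      [set t | `|p (val n, val i) - t| <= eps / 2]).
    have : (fun t : R => t) @ p (val n, val i) --> p (val n, val i) by exact: cvg_id.
    by move=> /cvgrPdist_le; apply; lra.
  apply: filterS pq => q pq qc; rewrite ler_distl; apply/andP; split.
    rewrite lerBlDr; apply: (approx _ _ _ M) => // n i nM iN.
    by rewrite distrC; exact: (pq (Ordinal nM) (Ordinal iN)).
  apply: (approx _ _ _ M) => // n i nM iN.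
  exact: (pq (Ordinal nM) (Ordinal iN)).
- move=> p q pq; apply: sup_S => t [->|[K VK [tK tp]]]; first exact: S_sup.
  apply: S_sup; right; exists K => //; split=> // n i iN.
  apply: le_trans (tp n i iN); rewrite lerD2l ler_wpM2l //.
  by rewrite lerB.
- move=> L VL; have /andP[fL0 fL1] := f01 _ VL.
  apply/eqP; rewrite eq_le; apply/andP; split.
    apply: S_sup; right; exists L => //; split=> // n i iN.
    by rewrite subrr mulr0 addr0.
  (* Were [f L < t], a level [n] bracketing [f K - f L] would provide a coordinate where [e K] is 1
     and [e L] is 0. Its constraint gives [t + w n <= f K], hence [t <= f L]. *)
  apply: sup_S => t [->//|[K VK [tK tp]]]; rewrite leNgt; apply/negP => Lt.
  have /andP[_ fK1] := f01 _ VK.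
  have [|n /andP[n1 n2]] := @dyadic_bracket R (f K - f L); first by lra.
  have [|i iN [eK eL]] := fe n K L VK VL; first by lra.
  by have := tp n i iN; rewrite eK eL subr0 mulr1 /w; lra.
Qed.

(** * Assembling the factorization *)

Unset Implicit Arguments.

Theorem theorem5p14 (R : realType) (X : Type) (f : set (pt R X) -> R) :
  (forall K, VcX K -> unit_int (f K)) ->
  Vc_continuous f -> Vc_monotone f ->
  exists (Y : Type), countable [set: Y] /\
  exists (s : pt R Y -> R) (h : Y -> pt R X -> R) (op : Y -> bool),
    (forall p, cube p -> unit_int (s p)) /\
    {within cube (R:=R) (X:=Y), continuous s} /\ cube_monotone s /\
    (forall y, (forall p, cube p -> unit_int (h y p)) /\
               {within cube (R:=R) (X:=X), continuous (h y)} /\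
               cube_monotone (h y)) /\
    (forall K, VcX K ->
       f K = s (fun y => modal (op y) (Vc_map (h y) K))).
Proof.
move=> f01 fc fm.
have /choice[F FP] (n : nat) : exists F, (forall i, urysohn (nth (trivial_modality X) F i).1) /\
    forall K L, VcX K -> VcX L -> f L + 2^-1 ^+ n <= f K ->
      exists2 i, (i < size F)%N & modal_splits (nth (trivial_modality X) F i) K L.
  have [|F uF FP] := finite_modal_separation (e := 2^-1 ^+ n) fc fm.
    by rewrite exprn_gt0 // invr_gt0.
  by exists F.
(* The index [(n, i)] names the [i]-th modal map for the gap [2^-n], so one countable index set
   serves all gaps. *)
pose g (y : nat * nat) := nth (trivial_modality X) (F y.1) y.2.
have ug y : urysohn (g y).1 by exact: (FP y.1).1.
have [s [s01 sc sm fs]] := @monotone_extension R _ (@VcX R X) f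
  (fun K y => modal (g y).2 (Vc_map (g y).1 K)) (fun n => size (F n)) f01
  (fun K y => modal_le1 _ _ _) (fun n => (FP n).2).
exists (nat * nat)%type; split; first exact: countableP.
exists s, (fun y => (g y).1), (fun y => (g y).2); split; first by [].
split=> //; split; first by move=> p q _ _; exact: sm.
split=> // y; have [hc hm hI] := ug y.
split; first by move=> p _; exact: hI.
by split; [exact: continuous_subspaceT|move=> p q _ _; exact: hm].
Qed.
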